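(* Let $q$ be a fixed prime power. The number of antichains in $\mathcal{V}(q,n)$ is \[2^{\left(1+O\left(\sqrt{n}\,q^{-n/4}\right)\right)\begin{bmatrix} n\\ \lfloor n/2\rfloor\end{bmatrix}_{q}}\] as $n\to\infty$.
   Context: For a prime power $q$ and integer $n\geq1$, $\mathcal{V}(q,n)$ denotes the poset of all linear subspaces of $\mathbb{F}_q^n$ ordered by inclusion. $\begin{bmatrix} n\\ i\end{bmatrix}_q$ denotes the number of $i$-dimensional subspaces of $\mathbb{F}_q^n$. An antichain is a set of pairwise incomparable elements. *)

(* Defs.v *)
From HB Require Import structures.
From mathcomp Require Import all_boot all_order all_algebra.
Set Implicit Arguments. Unset Strict Implicit. Unset Printing Implicit Defensive.
Import GRing.Theory.
Local Open Scope ring_scope.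

(* F plays the role of F_q (q = #|F|); vectors of F_q^n are row vectors 'rV[F]_n. *)

Definition is_subspace (F : finFieldType) (n : nat) (A : {set 'rV[F]_n}) : bool :=
  (0 \in A) && [forall u in A, forall v in A, forall a : F, a *: u + v \in A].

Definition subspace_dim (F : finFieldType) (n : nat) (A : {set 'rV[F]_n}) : nat :=
  \dim <<enum A>>%VS.

Definition is_antichain (F : finFieldType) (n : nat) (P : {set {set 'rV[F]_n}}) : bool :=
  [forall A in P, is_subspace A] &&
  [forall A in P, forall B in P, (A != B) ==> ~~ (A \subset B)].

Definition num_antichains (F : finFieldType) (n : nat) : nat :=
  #|[set P : {set {set 'rV[F]_n}} | is_antichain P]|.

Definition gauss_binom (F : finFieldType) (n i : nat) : nat :=
  #|[set A : {set 'rV[F]_n} | is_subspace A && (subspace_dim A == i)%N]|.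

(* Main.v *)
Require Import Defs.
From mathcomp Require Import all_boot all_algebra all_field zify.
Set Implicit Arguments. Unset Strict Implicit. Unset Printing Implicit Defensive.

(** Write L for the number of subspaces of the middle dimension, m for
    (n-1)/2 rounded down and Q = q^m.  The lower bound counts the subfamilies of
    the middle layer.

    For the upper bound, let A be a family of proper nonzero subspaces in which
    every member is comparable to at most D others.  A random complete flag
    contains X members of A, and X <= 1 + (number of nested pairs of A in it).
    A nested pair U < V lies in the flag with probability at most
    Q^-1 (P(U in flag) + P(V in flag)), and P(U in flag) >= 1/L, so taking
    expectations gives |A| (Q - D) <= Q L.  Hence a family that is much larger
    than L has a member of large degree in the comparability graph, and the
    Kleitman-Winston recursion i(A) <= i(A - v) + i(A - N[v]) bounds the number
    of antichains.  It is run twice: with D ~ n p r, which reduces the family to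
    2 L members, and then with D ~ p r, where r = q n and p ~ sqrt(Q / n).  The
    exponent lost is O(L / p + p r L / Q) = O(L sqrt(n) q^(-n/4)). *)

(** * Counting complete flags through ordered bases *)

Section FlagCounting.
Variables (F : finFieldType) (n : nat).
Local Notation vT := 'rV[F]_n.
Local Notation q := #|F|.
Implicit Types (s t : seq vT) (U V : {vspace vT}) (f g : seq vT -> nat).

Lemma free_rcons s (v : vT) : free (rcons s v) = (v \notin <<s>>%VS) && free s.
Proof. by rewrite -cats1 (perm_free (permEl (perm_catC _ _))) free_cons. Qed.

Lemma span_rcons s (v : vT) : <<rcons s v>>%VS = (<<s>> + <[v]>)%VS.
Proof. by rewrite -cats1 span_cat span_seq1. Qed.

Lemma card_gt1 : 1 < q. Proof. exact: finNzRing_gt1. Qed.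

Lemma card_vspace_rV U : #|U| = q ^ \dim U. Proof. exact: (card_vspace U). Qed.

Lemma card_vspaceD U V : (U <= V)%VS ->
  #|[pred v | (v \in V) && (v \notin U)]| = q ^ \dim V - q ^ \dim U.
Proof.
move=> /subvP UV; rewrite -!card_vspace_rV.
have <- : #|[predI V & U]| = #|U|.
  by apply: eq_card => v; rewrite !inE; apply: andb_idl => /UV.
rewrite -(cardID (mem U) (mem V)) addKn.
by apply: eq_card => v; rewrite !inE andbC.
Qed.

(** A complete flag is represented by the ordered bases whose prefixes span its members. Every flag
    comes from equally many bases, so sums over bases, built one vector outside the current span at
    a time, replace expectations over a random flag. *)
Fixpoint sum_ext k f s : nat :=
  if k is k'.+1 then \sum_(v : vT | v \notin <<s>>%VS) sum_ext k' f (rcons s v)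
  else f s.

Lemma sum_extD a c f s : sum_ext (a + c) f s = sum_ext a (sum_ext c f) s.
Proof.
elim: a s => //= a IH s; apply: eq_bigr => v _; exact: IH.
Qed.

Lemma leq_sum_ext k f g s : free s ->
  (forall t, free t -> size t = size s + k -> f t <= g t) ->
  sum_ext k f s <= sum_ext k g s.
Proof.
elim: k s => /= [|k IH] s fs H; first by apply: H; rewrite ?addn0.
apply: leq_sum => v vs; apply: IH; first by rewrite free_rcons vs.
by move=> t ft st; apply: H; rewrite // st size_rcons addSnnS.
Qed.

Lemma eq_sum_ext k f g s : free s ->
  (forall t, free t -> size t = size s + k -> f t = g t) ->
  sum_ext k f s = sum_ext k g s.
Proof.
move=> fs H; apply/eqP; rewrite eqn_leq !leq_sum_ext // => t ft st.
  by rewrite H.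
by rewrite H.
Qed.

Lemma sum_ext_add k f g s :
  sum_ext k (fun t => f t + g t) s = sum_ext k f s + sum_ext k g s.
Proof.
elim: k s => //= k IH s; rewrite -big_split /=.
by apply: eq_bigr => v _; rewrite IH.
Qed.

Lemma sum_ext_sum (I : finType) (P : pred I) (f : I -> seq vT -> nat) k s :
  sum_ext k (fun t => \sum_(i | P i) f i t) s = \sum_(i | P i) sum_ext k (f i) s.
Proof.
elim: k s => //= k IH s; rewrite exchange_big /=.
by apply: eq_bigr => v _; rewrite IH.
Qed.

(* The number of ways to extend i independent vectors to j independent
   vectors inside a space of dimension d. *)
Definition num_ext d i j := \prod_(i <= l < j) (q ^ d - q ^ l).

(** A vector outside U stays in the span and rules out spanning U. Inside U, the step at length l
    has q^(dim U) - q^l choices, and independence forces the last span to be U. *)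
Lemma sum_ext_span k s U : free s -> (<<s>> <= U)%VS -> \dim U = size s + k ->
  sum_ext k (fun t => (<<t>>%VS == U) : nat) s
  = num_ext (\dim U) (size s) (size s + k).
Proof.
elim: k s => /= [|k IH] s fs sU dU.
  rewrite addn0 /num_ext big_geq // eqEdim sU dU (eqP fs) addn0 leqnn //.
have out v : v \notin U -> sum_ext k (fun t => (<<t>>%VS == U) : nat) (rcons s v) = 0.
  move=> vU; have : v \in rcons s v by rewrite mem_rcons mem_head.
  elim: k {IH dU} (rcons s v) => /= [|k IH] t vt.
    case: eqP => // tU; case/negP: vU; rewrite -tU; exact: memv_span.
  by apply: big1 => w _; apply: IH; rewrite mem_rcons inE vt orbT.
rewrite (bigID (mem U)) /= [X in _ + X]big1 ?addn0 => [|v /andP[_ /out //]].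
rewrite (eq_bigr (fun=> num_ext (\dim U) (size s).+1 (size s + k.+1))); last first.
  move=> v /andP[vs vU]; rewrite IH ?free_rcons ?vs ?size_rcons ?addSnnS //.
  rewrite span_rcons; apply/subvP => w /memv_addP [x xs [y yv ->]].
  rewrite memvD //; first exact: (subvP sU).
  by move/vlineP: yv => [a ->]; rewrite memvZ.
rewrite sum_nat_const /num_ext [in RHS]big_ltn ?addnS ?ltnS ?leq_addr //.
congr (_ * _).
rewrite -{1}(eqP fs) -card_vspaceD //.
by apply: eq_card => v; rewrite !inE andbC.
Qed.

Lemma num_ext_gt0 d i j : j <= d -> 0 < num_ext d i j.
Proof.
move=> jd; rewrite /num_ext big_nat_cond prodn_cond_gt0 // => l.
by case/andP=> /andP[_ lj] _; rewrite subn_gt0 ltn_exp2l ?card_gt1 // (leq_trans lj).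
Qed.

Lemma num_ext_cat d i j k : i <= j -> j <= k ->
  num_ext d i k = num_ext d i j * num_ext d j k.
Proof. by move=> ij jk; rewrite /num_ext (big_cat_nat ij jk). Qed.

(* Factorwise, q^(d'-d) (q^d - q^l) = q^d' - q^(d'-d+l) <= q^d' - q^l. *)
Lemma leq_num_ext d d' i j : d <= d' ->
  num_ext d i j * q ^ ((d' - d) * (j - i)) <= num_ext d' i j.
Proof.
move=> dd; rewrite /num_ext.
have -> : q ^ ((d' - d) * (j - i)) = \prod_(i <= l < j) q ^ (d' - d).
  by rewrite prod_nat_const_nat expnM.
rewrite -big_split /=; apply: leq_prod => l _.
rewrite mulnBl -!expnD subnKC // leq_sub2l // leq_exp2l ?card_gt1 //.
exact: leq_addr.
Qed.

(** Three counts of ordered bases: all of them, those whose flag passes through one fixed subspace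
    of dimension [a], and those through one fixed nested pair of dimensions [a] and [b]. Divided by
    [num_flags], the last two are probabilities. *)
Definition num_flags := num_ext n 0 n.
Definition num_flags_at a := num_ext a 0 a * num_ext n a n.
Definition num_flags_at2 a b := num_ext a 0 a * num_ext b a b * num_ext n b n.

Lemma num_flags_at_gt0 a : a <= n -> 0 < num_flags_at a.
Proof. by move=> an; rewrite muln_gt0 !num_ext_gt0. Qed.

Lemma num_flags_gt0 : 0 < num_flags. Proof. exact: num_ext_gt0. Qed.

Lemma dim_rV : \dim {:vT} = n.
Proof. by rewrite dimvf /dim /= mul1n. Qed.

Lemma dim_le U : \dim U <= n.
Proof. by rewrite -[X in _ <= X]dim_rV dimvS ?subvf. Qed.

Lemma sum_ext1 a s : a <= n -> free s -> size s = a ->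
  sum_ext (n - a) (fun=> 1) s = num_ext n a n.
Proof.
move=> an fs sa; have := @sum_ext_span (n - a) s fullv fs (subvf _).
rewrite dim_rV sa subnKC // => <- //; apply: eq_sum_ext => // t ft st.
by rewrite eqEdim subvf dim_rV (eqP ft) st sa subnKC ?leqnn.
Qed.

Lemma num_flagsE : sum_ext n (fun=> 1) [::] = num_flags.
Proof. by rewrite -{1}[n]subn0 sum_ext1 // nil_free. Qed.

Definition in_flag U t := <<take (\dim U) t>>%VS == U.

Lemma sum_ext_take k f g s a : size s = a ->
  sum_ext k (fun t => f (take a t) * g t) s = f s * sum_ext k g s.
Proof.
move=> sa; suff: forall u, take a u = s ->
  sum_ext k (fun t => f (take a t) * g t) u = f s * sum_ext k g u.
  by apply; rewrite -sa take_size.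
elim: k => [|k IH] u us /=; first by rewrite us.
rewrite big_distrr; apply: eq_bigr => v _; apply: IH; rewrite -us -cats1 takel_cat //.
by rewrite -sa -us size_take; case: ltnP => // /ltnW.
Qed.

Lemma sum_extMr c f k s :
  sum_ext k (fun t => f t * c) s = sum_ext k f s * c.
Proof.
elim: k s => //= k IH s; rewrite big_distrl /=.
by apply: eq_bigr => v _; rewrite IH.
Qed.

Lemma sum_in_flag U :
  sum_ext n (fun t => in_flag U t : nat) [::] = num_flags_at (\dim U).
Proof.
set a := \dim U; rewrite -{1}(subnKC (dim_le U)) sum_extD.
rewrite (@eq_sum_ext _ _ (fun t => (<<t>>%VS == U) * num_ext n a n)) ?nil_free //.
  by rewrite sum_extMr sum_ext_span ?nil_free ?span_nil ?sub0v.
move=> t ft st; rewrite -(@sum_ext1 a t) ?dim_le //.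
rewrite -(@sum_ext_take _ (fun s => <<s>>%VS == U) (fun=> 1) t a) //.
by apply: eq_sum_ext => // u _ _; rewrite muln1.
Qed.

Lemma sum_in_flag2 U V : (U <= V)%VS ->
  sum_ext n (fun t => in_flag U t * in_flag V t) [::]
  = num_flags_at2 (\dim U) (\dim V).
Proof.
move=> UV; set a := \dim U; set b := \dim V.
have ab : a <= b by exact: dimvS.
have E : a + ((b - a) + (n - b)) = n by rewrite addnA !subnKC // dim_le.
rewrite -{1}E sum_extD.
rewrite (@eq_sum_ext _ _
  (fun t => (<<t>>%VS == U) * (num_ext b a b * num_ext n b n))) ?nil_free //.
  by rewrite sum_extMr sum_ext_span ?nil_free ?span_nil ?sub0v // mulnA.
move=> s fs; rewrite add0n => sa; rewrite sum_extD.
pose g t : nat := <<t>>%VS == V.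
rewrite (@eq_sum_ext _ _ (fun t => (<<take a t>>%VS == U) * (g t * num_ext n b n))) //.
  rewrite (@sum_ext_take _ (fun t => <<t>>%VS == U)) // sum_extMr.
  case: eqP => // sU; rewrite !mul1n /g sum_ext_span ?sU //.
    by rewrite sa subnKC.
  by rewrite sa subnKC.
move=> t ft; rewrite sa subnKC // => tb.
rewrite -(@sum_ext1 b t) ?dim_le //.
rewrite mulnA -(@sum_ext_take _ (fun s => (<<take a s>>%VS == U) * g s) (fun=> 1) t b) //.
by apply: eq_sum_ext => // u _ _; rewrite muln1 take_takel.
Qed.

Lemma in_flag_sub U V t : \dim U <= \dim V -> in_flag U t -> in_flag V t ->
  (U <= V)%VS.
Proof.
move=> ab /eqP <- /eqP <-; rewrite -(take_takel t ab).
by apply: sub_span => v /mem_take.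
Qed.

(** Conditioning on the larger space gains a factor q^(a(b-a)) with a(b-a) >= b-1; conditioning on
    the smaller one gains q^((n-b)(b-a)) with (n-b)(b-a) >= n-b. As b-1 and n-b add up to n-1, one
    of them reaches the required exponent. *)
Lemma num_flags_at2_le a b : 0 < a -> a < b -> b < n ->
  num_flags_at2 a b * q ^ ((n.-1)./2) <= num_flags_at a + num_flags_at b.
Proof.
move=> a0 ab bn; have q0 : 0 < q by apply: ltnW card_gt1.
have [nb|bn2] := leqP (n.-1)./2 b.-1.
  apply: leq_trans (leq_addl _ _).
  rewrite /num_flags_at (@num_ext_cat b 0 a b) ?(ltnW ab) // /num_flags_at2.
  rewrite mulnAC (mulnAC _ _ (q ^ _)) !leq_mul //.
  apply: leq_trans (leq_num_ext 0 a (ltnW ab)); rewrite leq_mul //.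
  by rewrite leq_exp2l ?card_gt1 //; nia.
apply: leq_trans (leq_addr _ _).
rewrite /num_flags_at (@num_ext_cat n a b n) ?(ltnW ab) ?(ltnW bn) // /num_flags_at2.
rewrite mulnA mulnAC leq_mul // -!mulnA leq_mul //.
apply: leq_trans (leq_num_ext a b (ltnW bn)); rewrite leq_mul //.
by rewrite leq_exp2l ?card_gt1 //; nia.
Qed.

(** The reciprocal form of the ratio of consecutive Gaussian binomials. *)
Lemma num_flags_atS a : a < n ->
  num_flags_at a.+1 * (q ^ (n - a) - 1) = num_flags_at a * (q ^ a.+1 - 1).
Proof.
move=> an; have q0 : 0 < q ^ a by rewrite expn_gt0 ltnW ?card_gt1.
have E : num_ext a.+1 0 a.+1 = (q ^ a.+1 - 1) * q ^ a * num_ext a 0 a.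
  rewrite /num_ext big_nat_recl // expn0 -mulnA; congr (_ * _).
  rewrite -{3}[a]subn0 -prod_nat_const_nat -big_split /=.
  by apply: eq_bigr => l _; rewrite mulnBr -!expnS.
have E2 : num_ext n a n = q ^ a * (q ^ (n - a) - 1) * num_ext n a.+1 n.
  by rewrite /num_ext big_ltn // mulnBr muln1 -expnD subnKC // ltnW.
rewrite /num_flags_at E E2; move: (num_ext _ _ _) (num_ext _ _ _) => x y.
by lia.
Qed.

(** By the ratio of consecutive values, the count does not increase from b to b+1 while b+1 <= n-b,
    and does not decrease once n-b <= b+1; so moving away from n/2 in either direction never lowers
    it. *)
Lemma num_flags_at_min a : a <= n -> num_flags_at (n %/ 2) <= num_flags_at a.
Proof.
move=> an; have q1 := card_gt1.
have step b : b < n -> n - b <= b.+1 -> num_flags_at b <= num_flags_at b.+1.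
  move=> bn nb; have E := num_flags_atS bn.
  have p : 0 < q ^ (n - b) - 1 by rewrite subn_gt0 -(exp1n (n - b)) ltn_exp2r // subn_gt0.
  by rewrite -(leq_pmul2r p) E leq_mul // leq_sub2r // leq_exp2l.
have step' b : b < n -> b.+1 <= n - b -> num_flags_at b.+1 <= num_flags_at b.
  move=> bn nb; have E := num_flags_atS bn.
  have p : 0 < q ^ b.+1 - 1 by rewrite subn_gt0 -(exp1n b.+1) ltn_exp2r.
  by rewrite -(leq_pmul2r p) -E leq_mul // leq_sub2r // leq_exp2l.
have up k : n %/ 2 + k <= n -> num_flags_at (n %/ 2) <= num_flags_at (n %/ 2 + k).
  elim: k => [|k IH] kn; first by rewrite addn0.
  rewrite addnS in kn *; apply: leq_trans (IH (ltnW kn)) (step _ kn _); lia.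
have down k : k <= n %/ 2 -> num_flags_at (n %/ 2) <= num_flags_at (n %/ 2 - k).
  elim: k => [|k IH] kn; first by rewrite subn0.
  apply: leq_trans (IH (ltnW kn)) _.
  have -> : n %/ 2 - k = (n %/ 2 - k.+1).+1 by lia.
  by apply: step'; lia.
have [le|le] := leqP (n %/ 2) a; first by rewrite -(subnKC le) up // subnKC.
by rewrite -[X in _ <= num_flags_at X](subKn (ltnW le)) down // leq_subr.
Qed.

End FlagCounting.

(** * Families of subspaces met by a random flag *)

Section Families.
Variables (F : finFieldType) (n : nat).
Local Notation vT := 'rV[F]_n.
Local Notation q := #|F|.
Local Notation L := (gauss_binom F n (n %/ 2)).
Implicit Types (A B : {set vT}) (P : {set {set vT}}).

Definition vs A : {vspace vT} := <<enum A>>%VS.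

Lemma mem_vs A : is_subspace A -> forall v, (v \in vs A) = (v \in A).
Proof.
case/andP=> A0 /forall_inP /= cl v; apply/idP/idP; last first.
  by move=> vA; apply: memv_span; rewrite mem_enum.
rewrite /vs; have : {subset enum A <= A} by move=> u; rewrite mem_enum.
elim: (enum A) v => [|w s IH] v sA; first by rewrite span_nil memv0 => /eqP ->.
rewrite span_cons => /memv_addP [x /vlineP [a ->] [y ys ->]].
have /forall_inP /= clw := cl w (sA w (mem_head _ _)).
have yA : y \in A by apply: IH ys => u us; apply: sA; rewrite inE us orbT.
exact: (forallP (clw y yA) a).
Qed.

Lemma sub_vs A B : is_subspace A -> is_subspace B ->
  (vs A <= vs B)%VS = (A \subset B).
Proof.
move=> sA sB; apply/subvP/subsetP => H v; move: (H v); by rewrite !mem_vs.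
Qed.

Lemma vs_inj A B : is_subspace A -> is_subspace B -> vs A = vs B -> A = B.
Proof. by move=> sA sB E; apply/setP => v; rewrite -!mem_vs // E. Qed.

Lemma set_of_vspace (U : {vspace vT}) :
  is_subspace [set v | v \in U] /\ vs [set v | v \in U] = U.
Proof.
have S : is_subspace [set v | v \in U].
  rewrite /is_subspace inE mem0v; apply/forall_inP => u uU.
  apply/forall_inP => v vU; apply/forallP => a.
  by move: uU vU; rewrite !inE => uU vU; rewrite memvD ?memvZ.
by split=> //; apply/vspaceP => v; rewrite mem_vs // inE.
Qed.

Lemma proper_dim A B : is_subspace A -> is_subspace B -> A \proper B ->
  subspace_dim A < subspace_dim B.
Proof.
move=> sA sB AB; rewrite ltn_neqAle dimvS ?sub_vs ?proper_sub // andbT.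
apply/eqP => E; move/proper_neq/eqP: (AB); apply; apply: vs_inj => //.
apply/eqP; rewrite eqEdim sub_vs ?proper_sub //=.
by rewrite -[\dim (vs B)]/(subspace_dim B) -E.
Qed.

(** The members met by one flag form a chain. If there are X >= 1 of them, the one of least
    dimension lies properly inside each of the others, which already gives X - 1 nested pairs. *)
Lemma leq_flag_chain P t : (forall A, A \in P -> is_subspace A) ->
  \sum_(A in P) in_flag (vs A) t <=
  1 + \sum_(A in P) \sum_(B in P | A \proper B) in_flag (vs A) t * in_flag (vs B) t.
Proof.
move=> sP.
case: (pickP [pred A in P | in_flag (vs A) t]) => [A0 PA0 | no]; last first.
  by rewrite big1 // => A PA; move: (no A); rewrite /= PA /= => ->.
case: (arg_minnP (fun A => subspace_dim A) PA0) => A /= /andP[PA fA] minA.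
rewrite (bigD1 A) //= fA leq_add2l.
rewrite [X in _ <= X](bigD1 A) //= fA; apply: leq_trans (leq_addr _ _).
rewrite big_mkcond /= [X in _ <= X]big_mkcond /=; apply: leq_sum => B _.
case: (boolP (B \in P)) => //= PB; case: eqP => //= BA.
case fB: (in_flag (vs B) t); last by case: ifP.
suff -> : A \proper B by [].
have := minA B; rewrite PB fB => /(_ isT) dAB.
have := in_flag_sub dAB fA fB; rewrite sub_vs ?sP // properEneq => ->.
by rewrite andbT; apply/eqP => E; apply: BA.
Qed.

Lemma sum_num_flags_le P : (forall A, A \in P -> is_subspace A) ->
  \sum_(A in P) num_flags_at F n (subspace_dim A) <=
  num_flags F n + \sum_(A in P) \sum_(B in P | A \proper B)
    num_flags_at2 F n (subspace_dim A) (subspace_dim B).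
Proof.
move=> sP; rewrite -num_flagsE.
under eq_bigr => A _ do rewrite -sum_in_flag.
under [X in _ <= _ + X]eq_bigr => A PA.
  under eq_bigr => B PB.
    case/andP: PB => PB AB.
    rewrite -sum_in_flag2 ?sub_vs ?sP ?proper_sub //.
    over.
  rewrite -sum_ext_sum; over.
rewrite -!sum_ext_sum -sum_ext_add; apply: leq_sum_ext; first exact: nil_free.
by move=> t _ _; apply: leq_flag_chain.
Qed.

(** Double counting: the flag of each ordered basis contains exactly one subspace of dimension [a],
    the span of its first [a] vectors. *)
Lemma gauss_binom_flags a : a <= n ->
  gauss_binom F n a * num_flags_at F n a = num_flags F n.
Proof.
move=> an; rewrite /gauss_binom -sum_nat_const -num_flagsE.
transitivity (\sum_(A in [set A | is_subspace A && (subspace_dim A == a)])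
    sum_ext n (fun t => in_flag (vs A) t : nat) [::]).
  by apply: eq_bigr => A; rewrite inE sum_in_flag => /andP[_ /eqP <-].
rewrite -sum_ext_sum; apply: eq_sum_ext; first exact: nil_free.
move=> t ft; rewrite add0n => st.
have [sU vU] := set_of_vspace <<take a t>>%VS.
have dU : \dim <<take a t>>%VS = a.
  have : free (take a t) by move: ft; rewrite -{1}(cat_take_drop a t) => /catl_free.
  by move/eqP->; rewrite size_takel // st.
rewrite (bigD1 [set v | v \in <<take a t>>%VS]) /=; last first.
  by rewrite inE sU /subspace_dim -/(vs _) vU dU /=.
rewrite big1 /in_flag ?vU ?dU ?eqxx // => A /andP[].
rewrite inE => /andP[sA /eqP dA] neq.
have -> : \dim (vs A) = a by exact: dA.
case: eqP => // E.
by case/eqP: neq; apply: vs_inj => //; rewrite vU E.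
Qed.

Lemma half_le : n %/ 2 <= n. Proof. exact: leq_div. Qed.

Lemma num_flags_le_at a : a <= n -> num_flags F n <= num_flags_at F n a * L.
Proof.
by move=> an; rewrite -(gauss_binom_flags half_le) mulnC leq_mul ?num_flags_at_min.
Qed.

Lemma gauss_binom_le a : a <= n -> gauss_binom F n a <= L.
Proof.
move=> an; rewrite -(leq_pmul2r (num_flags_at_gt0 F an)) gauss_binom_flags // mulnC.
exact: num_flags_le_at.
Qed.

Lemma card_subspaces_le P : (forall A, A \in P -> is_subspace A) ->
  #|P| <= n.+1 * L.
Proof.
move=> sP; rewrite -sum1_card.
rewrite (partition_big (fun A => inord (subspace_dim A) : 'I_n.+1) xpredT) //=.
rewrite -[X in _ <= X * _]card_ord -sum_nat_const; apply: leq_sum => i _.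
apply: leq_trans (gauss_binom_le (ltn_ord i : i <= n)).
rewrite sum1_card; apply: subset_leq_card; apply/subsetP => A; rewrite !inE.
case/andP=> /sP sA /eqP <-; rewrite inordK ?sA ?eqxx // ltnS; exact: dim_le.
Qed.

Lemma leq_exp_gauss_binom : 1 < n -> q ^ (n.-1)./2 <= L.
Proof.
move=> n1.
have h : 0 < n %/ 2 /\ n %/ 2 < n by lia.
have n0 := num_flags_at_gt0 F half_le.
rewrite -(leq_pmul2r n0) gauss_binom_flags ?half_le // /num_flags /num_flags_at.
rewrite (@num_ext_cat F n 0 (n %/ 2) n) ?half_le // mulnA leq_mul // mulnC.
apply: leq_trans (leq_num_ext F 0 _ half_le); rewrite leq_mul //.
rewrite leq_exp2l ?card_gt1 //; nia.
Qed.

Definition nested A B := (A \proper B) || (B \proper A).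

(* Every comparable pair A < B has num_flags_at2 at most q^-m times
   num_flags_at A + num_flags_at B, and each A is charged at most D times. *)
Lemma card_sparse_family P D :
  (forall A, A \in P -> is_subspace A && (0 < subspace_dim A < n)) ->
  (forall A, A \in P -> #|[set B in P | nested A B]| <= D) ->
  D <= q ^ (n.-1)./2 ->
  #|P| * q ^ (n.-1)./2 <= q ^ (n.-1)./2 * L + D * #|P|.
Proof.
set Q := q ^ _; move=> hP deg DQ.
have sP A : A \in P -> is_subspace A by case/hP/andP.
set c := fun A => num_flags_at F n (subspace_dim A).
set S := \sum_(A in P) c A.
have S1 : S * Q <= num_flags F n * Q + D * S.
  apply: leq_trans (leq_mul (sum_num_flags_le sP) (leqnn Q)) _.
  rewrite mulnDl leq_add2l big_distrl /=.
  apply: (@leq_trans (\sum_(A in P) \sum_(B in P | A \proper B) (c A + c B))).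
    apply: leq_sum => A PA; rewrite big_distrl /=; apply: leq_sum => B /andP[PB AB].
    have [/andP[sA /andP[a0 an]] /andP[sB /andP[b0 bn]]] := (hP A PA, hP B PB).
    by apply: num_flags_at2_le => //; apply: proper_dim.
  under eq_bigr => A _ do rewrite big_split /=.
  rewrite big_split /=.
  (* After the exchange, [c A] is charged once for each member above A and once for each member
     below A. These two sets are disjoint, so together they have at most D elements. *)
  rewrite [X in _ + X](exchange_big_dep (mem P)) /=; last by move=> A B _ /andP[].
  rewrite -big_split /= big_distrr /=; apply: leq_sum => A PA.
  rewrite !sum_nat_const -mulnDl leq_mul2r; apply/orP; right.
  apply: leq_trans (deg A PA); rewrite -cardUI.
  rewrite [X in _ + X](_ : _ = 0) ?addn0; last first.
    apply: eq_card0 => B; rewrite !inE -!topredE /=; apply/negbTE/negP.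
    by case/andP=> /andP[_ /proper_sub AB] /and3P[_ _ /properP[_ [v vA /negP[]]]];
      apply: (subsetP AB).
  apply: subset_leq_card; apply/subsetP => B; rewrite !inE -!topredE /= /nested.
  by case/orP=> [/andP[PB AB]|/and3P[PB _ AB]]; rewrite AB ?orbT andbT; exact: PB.
have S2 : #|P| * num_flags F n <= S * L.
  rewrite -sum_nat_const big_distrl /=; apply: leq_sum => A PA.
  exact/num_flags_le_at/dim_le.
have T0 := num_flags_gt0 F n.
suff : #|P| * (Q - D) <= Q * L by rewrite mulnBr leq_subLR [_ * D]mulnC addnC.
rewrite -(leq_pmul2r T0).
have : S * (Q - D) <= num_flags F n * Q by rewrite mulnBr leq_subLR [_ * D]mulnC addnC.
move: S2; move: (Q - D) => E S2 S3.
rewrite mulnAC; apply: leq_trans (leq_mul S2 (leqnn E)) _.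
by rewrite mulnAC; apply: leq_trans (leq_mul S3 (leqnn L)) _; rewrite -mulnA mulnC.
Qed.
End Families.

(** * Counting stable sets of a graph *)

Section StableSets.
Variables (T : finType) (e : rel T).
Hypotheses (e_irr : irreflexive e).
Implicit Types (I V W : {set T}).

Definition stable I := [forall x in I, forall y in I, ~~ e x y].
Definition num_stable V := #|[set I : {set T} | (I \subset V) && stable I]|.

Lemma stable_sub I V : I \subset V -> stable V -> stable I.
Proof.
move=> /subsetP IV /forall_inP /= H; apply/forall_inP => x /IV xV.
by apply/forall_inP => y /IV yV; move/forall_inP: (H x xV); apply.
Qed.

Lemma num_stableS V W : V \subset W -> num_stable V <= num_stable W.
Proof.
move=> VW; apply: subset_leq_card; apply/subsetP => I; rewrite !inE.
by case/andP=> IV ->; rewrite (subset_trans IV VW).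
Qed.

Lemma num_stable_leq_exp V : num_stable V <= 2 ^ #|V|.
Proof.
rewrite -card_powerset; apply: subset_leq_card; apply/subsetP => I.
by rewrite !inE => /andP[].
Qed.

(** Stable sets are split by whether they contain v. Deleting v is injective on those that do, and
    what remains avoids the neighbours of v. *)
Lemma num_stable_rec V v : v \in V ->
  num_stable V <= num_stable (V :\ v) +
                  num_stable ((V :\ v) :\: [set u in V | e v u]).
Proof.
move=> vV; rewrite {1}/num_stable -(cardsID [set I : {set T} | v \in I]) addnC.
apply: leq_add.
  apply: subset_leq_card; apply/subsetP => I; rewrite !inE.
  case/and3P=> vI IV ->; rewrite andbT subsetD1 IV; exact: vI.
rewrite -(card_in_imset (f := fun I => I :\ v)); last first.
  move=> I J; rewrite !inE => /andP[_ vI] /andP[_ vJ] E.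
  by rewrite -(setD1K vI) -(setD1K vJ) E.
apply: subset_leq_card; apply/subsetP => _ /imsetP [I + ->]; rewrite !inE.
case/andP=> /andP[IV stI] vI; rewrite (stable_sub (subsetDl _ _) stI) andbT.
apply/subsetP => u; rewrite !inE => /andP[-> uI].
rewrite (subsetP IV) //= andbT.
by move/forall_inP: stI => /(_ v vI) /forall_inP; apply.
Qed.

Lemma card_setD_nbr V v : v \in V ->
  #|(V :\ v) :\: [set u in V | e v u]| + #|[set u in V | e v u]| = #|V|.-1.
Proof.
move=> vV; have -> : #|V|.-1 = #|V :\ v| by rewrite [#|V|](cardsD1 v) vV.
rewrite -(cardsID [set u in V | e v u] (V :\ v)) addnC; congr (_ + _).
apply: eq_card => u; rewrite !inE; case: (u =P v) => [->|] /=; first by rewrite e_irr andbF.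
by rewrite andbA andbb.
Qed.

Lemma num_stable_leq2 V v : num_stable V <= 2 * num_stable (V :\ v).
Proof.
have [vV|vV] := boolP (v \in V); last first.
  by rewrite (setDidPl _) ?leq_pmull // disjoint_sym disjoints1.
apply: leq_trans (num_stable_rec vV) _; rewrite mul2n -addnn leq_add2l.
exact/num_stableS/subsetDl.
Qed.
End StableSets.

(** * Antichains as stable sets of the comparability graph *)

Section Antichains.
Variables (F : finFieldType) (n : nat).
Local Notation vT := 'rV[F]_n.
Local Notation q := #|F|.
Local Notation L := (gauss_binom F n (n %/ 2)).
Implicit Types (A B : {set vT}) (P : {set {set vT}}).

Lemma nested_irr : irreflexive (@nested F n).
Proof. by move=> A; rewrite /nested properxx. Qed.

Lemma num_antichainsE :
  num_antichains F n = num_stable (@nested F n) [set A | is_subspace A].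
Proof.
apply: eq_card => P; rewrite !inE /is_antichain; congr (_ && _).
  apply/forall_inP/subsetP => H A /H; by rewrite ?inE.
apply/forall_inP/forall_inP => /= H A PA; apply/forall_inP => B PB.
  rewrite /nested !properEneq.
  move/forall_inP: (H A PA) => /(_ B PB) h1; move/forall_inP: (H B PB) => /(_ A PA).
  move: h1; rewrite [B == A]eq_sym; case: (A == B) => //=.
  by move=> /negbTE -> /negbTE ->.
apply/implyP => AB; move/forall_inP: (H A PA) => /(_ B PB).
by rewrite /nested !properEneq AB /= negb_or => /andP[].
Qed.

Definition proper_subspaces : {set {set vT}} :=
  [set A | is_subspace A && (0 < subspace_dim A < n)].

(** The zero space and the full space are discarded, each at the cost of a factor 2, because the
    estimate for nested pairs in a flag needs dimensions strictly between 0 and n. *)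
Lemma num_antichains_le :
  num_antichains F n <= 4 * num_stable (@nested F n) proper_subspaces.
Proof.
rewrite num_antichainsE; set V := [set A | is_subspace A].
pose Z := [set v : vT | v \in 0%VS]; pose W := [set v : vT | v \in fullv].
have [sZ vZ] := set_of_vspace (0%VS : {vspace vT}).
have [sW vW] := set_of_vspace (fullv : {vspace vT}).
apply: leq_trans (num_stable_leq2 _ V Z) _.
rewrite -[4]/(2 * 2) -mulnA leq_mul2l /=.
apply: leq_trans (num_stable_leq2 _ _ W) _; rewrite leq_mul2l /=.
apply/num_stableS/subsetP => A; rewrite !inE => /and3P[AW AZ sA]; rewrite sA /=.
apply/andP; split.
  rewrite lt0n; apply: contra AZ => A0; apply/eqP/vs_inj => //; rewrite vZ.
  by apply/eqP; rewrite -dimv_eq0.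
rewrite ltn_neqAle dim_le andbT; apply: contra AW => A0; apply/eqP/vs_inj => //.
by rewrite vW; apply/eqP; rewrite eqEdim subvf dim_rV -[X in X <= _](eqP A0) leqnn.
Qed.

Lemma num_antichains_ge : 2 ^ L <= num_antichains F n.
Proof.
rewrite -card_powerset; apply: subset_leq_card; apply/subsetP => P; rewrite !inE.
move/subsetP => sP; apply/andP; split.
  by apply/forall_inP => A /sP; rewrite inE => /andP[].
apply/forall_inP => A /sP; rewrite inE => /andP[sA /eqP dA].
apply/forall_inP => B /sP; rewrite inE => /andP[sB /eqP dB].
apply/implyP => AB; apply/negP => sAB.
have := @proper_dim _ _ A B sA sB; rewrite properEneq AB sAB dA dB ltnn.
by move/(_ isT).
Qed.

(** With D at most Q/2, the term D |P| of the sparse family bound is absorbed into half of |P| Q. *)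
Lemma sparse_half_family P D :
  P \subset proper_subspaces ->
  (forall A, A \in P -> #|[set B in P | nested A B]| <= D) ->
  2 * D <= q ^ (n.-1)./2 -> #|P| <= 2 * L.
Proof.
move=> /subsetP hP deg DQ.
have Q0 : 0 < q ^ (n.-1)./2 by rewrite expn_gt0 ltnW ?card_gt1.
have hP' A : A \in P -> is_subspace A && (0 < subspace_dim A < n).
  by move/hP; rewrite inE.
have := card_sparse_family hP' deg; move: Q0 DQ; move: (q ^ _) => Q Q0 DQ H.
have {}H : #|P| * Q <= Q * L + D * #|P| by apply: H; lia.
rewrite -(leq_pmul2r Q0); have := leq_mul DQ (leqnn #|P|); nia.
Qed.
End Antichains.

Lemma eventually_cube_le_exp q c : 1 < q ->
  exists N, forall n, N <= n -> c * n ^ 3 <= q ^ (n.-1)./2.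
Proof.
(* With k about n/8, the right side is at least 2^(4k) >= (k+1)^4. Since n <= 10 (k+1), the left
   side is at most 1000 c (k+1)^3, and this threshold makes 1000 c <= k+1. *)
move=> q1; exists (10 * (1000 * c).+1) => n nN.
set k := (n.-1)./2 %/ 4.
have h : n <= 10 * k.+1 by rewrite /k; lia.
have hk : 1000 * c <= k.+1 by clearbody k; lia.
apply: (@leq_trans ((2 ^ k) ^ 4)); last first.
  rewrite -expnM; apply: (@leq_trans (2 ^ (n.-1)./2)).
    by rewrite leq_exp2l // /k; lia.
  by case: (n.-1)./2 => // j; rewrite leq_exp2r.
apply: (@leq_trans (k.+1 ^ 4)); last by rewrite leq_exp2r // ltn_expl.
apply: (@leq_trans (c * (10 * k.+1) ^ 3)); first by rewrite leq_mul2l leq_exp2r // h orbT.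
rewrite expnMn mulnA (expnS k.+1 3) leq_mul2r; apply/orP; right; lia.
Qed.

(* The container bound with real weights *)
From Stdlib Require Import Reals Lra.
Open Scope R_scope.

Lemma INR_addn a b : INR (a + b)%nat = INR a + INR b.
Proof. exact: plus_INR. Qed.

Lemma INR_muln a b : INR (a * b)%nat = INR a * INR b.
Proof. exact: mult_INR. Qed.

Lemma INR_expn a b : INR (expn a b) = INR a ^ b.
Proof. by elim: b => [|b IH] //; rewrite expnS INR_muln IH. Qed.

Lemma INR_leq a b : (a <= b)%nat -> INR a <= INR b.
Proof. by move/leP/le_INR. Qed.

Lemma INR_ltn a b : (a < b)%nat -> INR a < INR b.
Proof. by move/ltP/lt_INR. Qed.

Section Containers.
Variables (T : finType) (e : rel T).
Hypothesis e_irr : irreflexive e.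

(* Kleitman-Winston: a stable set either avoids a vertex v of degree at
   least D, or contains v and avoids its neighbours, and
   lam^(N-1) + lam^(N-1-D) <= lam^N. *)
Lemma num_stable_container (D : nat) (lam K : R) (V : {set T}) :
  1 <= lam -> 1 <= lam ^ D * (lam - 1) -> 0 <= K ->
  (forall A : {set T}, A \subset V ->
     (forall v, v \in A -> (#|[set u in A | e v u]| < D)%nat) ->
     INR (num_stable e A) <= K) ->
  INR (num_stable e V) <= K * lam ^ #|V|.
Proof.
move=> lam1 lamD K0; have [N] := ubnP #|V|; elim: N V => // N IH V VN H.
case: (pickP [pred v in V | (D <= #|[set u in V | e v u]|)%nat]) => [v | no]; last first.
  apply: Rle_trans (_ : K * 1 <= _); last first.
    by apply: Rmult_le_compat_l => //; apply: pow_R1_Rle.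
  rewrite Rmult_1_r; apply: H => // v vV; rewrite ltnNge.
  by move: (no v); rewrite /= vV /= => ->.
case/andP=> vV degv.
have E := card_setD_nbr e_irr vV.
set W := (V :\ v) :\: [set u in V | e v u] in E *.
have cV : #|V| = #|V :\ v|.+1 by rewrite (cardsD1 v) vV.
have sV1 : V :\ v \subset V by exact: subsetDl.
have sW : W \subset V by apply: subset_trans (subsetDl _ _) sV1.
have I1 : INR (num_stable e (V :\ v)) <= K * lam ^ #|V :\ v|.
  apply: IH => [|A AV]; first by rewrite -ltnS -cV.
  by apply: H; apply: subset_trans AV sV1.
have I2 : INR (num_stable e W) <= K * lam ^ #|W|.
  apply: IH => [|A AV]; last by apply: H; apply: subset_trans AV sW.
  by apply: leq_ltn_trans (subset_leq_card (subsetDl _ _)) _; rewrite -ltnS -cV.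
apply: Rle_trans (INR_leq (num_stable_rec e vV)) _; rewrite INR_addn -/W.
apply: Rle_trans (Rplus_le_compat _ _ _ _ I1 I2) _.
rewrite -Rmult_plus_distr_l; apply: Rmult_le_compat_l => //.
have WD : (#|W| + D <= #|V :\ v|)%nat by rewrite -[#|V :\ v|]/(#|V :\ v|.+1.-1) -cV -E leq_add2l.
have -> : lam ^ #|V| = lam ^ #|V :\ v| + lam ^ #|V :\ v| * (lam - 1).
  by rewrite cV /=; ring.
apply: Rplus_le_compat_l.
(* W misses at least D vertices of [V :\ v], and the hypothesis 1 <= lam^D (lam - 1) turns this loss
   into the summand still needed. *)
apply: Rle_trans (_ : lam ^ (#|W| + D) * (lam - 1) <= _); last first.
  by apply: Rmult_le_compat_r; [lra | apply: Rle_pow => //; apply/leP].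
have P := pow_R1_Rle lam #|W| lam1.
rewrite pow_add Rmult_assoc -{1}[lam ^ #|W|]Rmult_1_r.
by apply: Rmult_le_compat_l; lra.
Qed.
End Containers.

(* (1 + 1/p)^p >= 2 by Bernoulli, so D = p r with 2^r >= p suffices. *)
Lemma one_add_inv_pow_ge (p r : nat) : (0 < p)%nat -> (p <= expn 2 r)%nat ->
  1 <= (1 + / INR p) ^ (p * r) * ((1 + / INR p) - 1).
Proof.
move=> p0 pr; have P : 0 < INR p by exact: (INR_ltn p0).
have Pi := Rinv_0_lt_compat _ P.
have B : 2 <= (1 + / INR p) ^ p.
  have := poly p _ Pi; rewrite Rinv_r; lra.
rewrite pow_mult; have E : (1 + / INR p) - 1 = / INR p by ring.
rewrite E; have B2 : INR p <= ((1 + / INR p) ^ p) ^ r.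
  apply: Rle_trans (INR_leq pr) _; rewrite INR_expn; apply: pow_incr.
  by split; [apply: pos_INR|].
apply: Rle_trans (_ : INR p * / INR p <= _); first by rewrite Rinv_r; lra.
by apply: Rmult_le_compat_r => //; lra.
Qed.

Lemma ln_le x y : 0 < x -> x <= y -> ln x <= ln y.
Proof. by move=> x0 [/(ln_increasing _ _ x0)|->]; lra. Qed.

Lemma pow_le_exp (x : R) k : 0 <= x -> (1 + x) ^ k <= exp (INR k * x).
Proof.
move=> x0; elim: k => [|k IH]; first by rewrite /= Rmult_0_l exp_0; lra.
rewrite S_INR Rmult_plus_distr_r Rmult_1_l exp_plus /= Rmult_comm.
apply: Rmult_le_compat => //; [by apply: pow_le; lra | lra|].
by have := exp_ineq1_le x; lra.
Qed.

(** * The two container rounds *)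

Section UpperBound.
Variables (F : finFieldType) (n p r : nat).
Local Notation L := (gauss_binom F n (n %/ 2)).
Local Notation Q := (expn #|F| (n.-1)./2).
Local Notation nested := (@nested F n).
Hypotheses (n_gt1 : (1 < n)%nat) (p_gt0 : (0 < p)%nat).
Hypotheses (npr : (n * p <= expn 2 r)%nat) (nprQ : (2 * (n * p * r) <= Q)%nat).

Let p_pos : 0 < INR p. Proof. exact: (INR_ltn p_gt0). Qed.
Let n_pos : 0 < INR n. Proof. by apply: (INR_ltn (ltnW n_gt1)). Qed.
Let Q_gt0 : (0 < Q)%nat.
Proof. by rewrite expn_gt0 ltnW ?card_gt1. Qed.
Let Q_pos : 0 < INR Q. Proof. exact: (INR_ltn Q_gt0). Qed.

Lemma two_powE k : INR (expn 2 k) = Rpower 2 (INR k).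
Proof. by rewrite INR_expn Rpower_pow //; lra. Qed.

(** Second round, with D = p r and lam = 1 + 1/p. A sparse remainder A satisfies |A| Q <= Q L + p r
    |A|; inserting |A| <= 2 L on the right gives the exponent of 2, and lam^(2 L) gives the
    exponential factor. *)
Lemma num_stable_half (V : {set {set 'rV[F]_n}}) :
  V \subset proper_subspaces F n -> (#|V| <= 2 * L)%nat ->
  INR (num_stable nested V) <=
  Rpower 2 (INR L + 2 * INR p * INR r * INR L / INR Q) * exp (2 * INR L / INR p).
Proof.
move=> VP V2.
set K := Rpower 2 _; have K0 : 0 < K by exact: exp_pos.
have pi := Rinv_0_lt_compat _ p_pos.
have p2r : (p <= expn 2 r)%nat by apply: leq_trans npr; rewrite leq_pmull // ltnW.
apply: Rle_trans (@num_stable_container _ _ (@nested_irr F n) (p * r)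
  (1 + / INR p) K V _ _ _ _) _; [lra | exact: one_add_inv_pow_ge | lra | | ].
- move=> A AV deg; apply: Rle_trans (INR_leq (num_stable_leq_exp _ _)) _.
  rewrite two_powE; apply: Rle_Rpower; first lra.
  have hA B : B \in A -> is_subspace B && (0 < subspace_dim B < n)%nat.
    by move=> BA; have := subsetP (subset_trans AV VP) _ BA; rewrite inE.
  have prQ : (p * r <= Q)%nat.
    apply: leq_trans nprQ; rewrite -mulnA mulnA leq_pmull //.
    by rewrite muln_gt0 (ltnW n_gt1).
  have := INR_leq (card_sparse_family hA (fun B BA => ltnW (deg B BA)) prQ).
  rewrite INR_addn !INR_muln => H.
  have A2 : INR #|A| <= 2 * INR L.
    by rewrite -[2]/(INR 2) -INR_muln; apply: INR_leq; apply: leq_trans (subset_leq_card AV) V2.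
  have pr0 : 0 <= INR p * INR r by apply: Rmult_le_pos; apply: pos_INR.
  have H2 := Rmult_le_compat_l _ _ _ pr0 A2.
  apply: (Rmult_le_reg_r (INR Q)) => //.
  have -> : (INR L + 2 * INR p * INR r * INR L / INR Q) * INR Q
    = INR Q * INR L + INR p * INR r * (2 * INR L) by field; lra.
  apply: Rle_trans H _; exact: Rplus_le_compat_l.
apply: Rmult_le_compat_l; first lra.
apply: Rle_trans (pow_le_exp _ _) _; first lra.
have V2' : INR #|V| <= 2 * INR L.
  by rewrite -[2]/(INR 2) -INR_muln; exact: INR_leq.
have := Rmult_le_compat_r (/ INR p) _ _ (Rlt_le _ _ pi) V2'.
by case=> [lt|->]; [left; exact: exp_increasing | right].
Qed.

(** First round, with D = n p r and lam = 1 + 1/(n p). All n+1 layers together have at most 2 n L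
    members, so the weight costs exp(2 L / p); the sparse remainders have at most 2 L members and go
    to the second round. *)
Lemma num_stable_proper_subspaces :
  INR (num_stable nested (proper_subspaces F n)) <=
  Rpower 2 (INR L + 2 * INR p * INR r * INR L / INR Q) * exp (4 * INR L / INR p).
Proof.
set K := Rpower 2 _; have K0 : 0 < K by exact: exp_pos.
have np_pos : 0 < INR (n * p).
  by rewrite INR_muln; apply: Rmult_lt_0_compat.
have npi := Rinv_0_lt_compat _ np_pos.
apply: Rle_trans (@num_stable_container _ _ (@nested_irr F n) (n * p * r)
  (1 + / INR (n * p)) (K * exp (2 * INR L / INR p)) _ _ _ _ _) _.
- lra.
- by apply: one_add_inv_pow_ge => //; rewrite muln_gt0 (ltnW n_gt1).
- by apply: Rmult_le_pos; [lra | left; exact: exp_pos].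
- move=> A AP deg; apply: num_stable_half => //.
  by apply: sparse_half_family AP (fun B BA => ltnW (deg B BA)) nprQ.
rewrite Rmult_assoc; apply: Rmult_le_compat_l; first lra.
have -> : 4 * INR L / INR p = 2 * INR L / INR p + 2 * INR L / INR p by field; lra.
rewrite exp_plus; apply: Rmult_le_compat_l; first by left; exact: exp_pos.
apply: Rle_trans (pow_le_exp _ _) _; first lra.
have V2' : INR #|proper_subspaces F n| <= (2 * INR n) * INR L.
  rewrite -[2]/(INR 2) -!INR_muln; apply: INR_leq.
  apply: leq_trans (card_subspaces_le _) _; first by move=> A; rewrite inE => /andP[].
  by rewrite leq_mul2r; apply/orP; right; lia.
have := Rmult_le_compat_r _ _ _ (Rlt_le _ _ npi) V2'.
have -> : 2 * INR n * INR L * / INR (n * p) = 2 * INR L / INR p.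
  by rewrite INR_muln; field; lra.
by case=> [lt|->]; [left; exact: exp_increasing | right].
Qed.

Lemma ln_num_antichains_le :
  ln (INR (num_antichains F n)) <=
  (2 + INR L + 2 * INR p * INR r * INR L / INR Q) * ln 2 + 4 * INR L / INR p.
Proof.
have N0 : 0 < INR (num_antichains F n).
  by apply: (INR_ltn (a := 0)); apply: leq_trans (num_antichains_ge F n); rewrite expn_gt0.
have := INR_leq (num_antichains_le F n); rewrite INR_muln => H1.
have H2 := num_stable_proper_subspaces.
have K0 : 0 < Rpower 2 (INR L + 2 * INR p * INR r * INR L / INR Q) by exact: exp_pos.
have : INR (num_antichains F n) <= 4 * (Rpower 2 (INR L + 2 * INR p * INR r * INR L / INR Q) *
    exp (4 * INR L / INR p)).
  apply: Rle_trans H1 _; rewrite [INR 4](_ : _ = 4); last by rewrite /=; lra.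
  by apply: Rmult_le_compat_l; lra.
move/(ln_le N0) => H; apply: Rle_trans H _.
have E0 := exp_pos (4 * INR L / INR p).
rewrite ln_mult; [|lra|exact: Rmult_lt_0_compat].
rewrite ln_mult // ln_exp /Rpower ln_exp.
have -> : ln 4 = 2 * ln 2 by rewrite (_ : 4 = 2 * 2); [rewrite ln_mult; lra | lra].
lra.
Qed.
End UpperBound.

(* The condition on Q gives 2 n p (q n) <= Q, since (2 n p q n)^2 <= 4 q^2 n^3 Q. *)
Lemma choose_scale (q n Q : nat) : (1 < q)%nat -> (0 < n)%nat ->
  (4 * expn q 2 * expn n 3 <= Q)%nat ->
  exists p : nat, [/\ (0 < p)%nat, (2 * (n * p * (q * n)) <= Q)%nat,
    (n * expn p 2 <= Q)%nat & (Q < n * expn p.+1 2)%nat].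
Proof.
move=> q1 n0 H; pose P p := (n * expn p 2 <= Q)%nat.
have exP : exists p, P p by exists O; rewrite /P muln0.
have bP p : P p -> (p <= Q)%nat.
  by move=> Pp; apply: leq_trans Pp; case: p => // p; rewrite expnS mulnCA leq_pmulr // muln_gt0 n0.
(* The largest p with n p^2 <= Q, that is, sqrt(Q/n) rounded down. *)
case: (ex_maxnP exP bP) => p Pp maxp; exists p.
have P1 : P 1%nat.
  by rewrite /P exp1n muln1; apply: leq_trans H; rewrite (expnS n 2) mulnCA leq_pmulr //
    !muln_gt0 n0 (ltnW q1).
split=> //; first exact: maxp; last by rewrite ltnNge; apply/negP => /maxp; rewrite ltnn.
rewrite -(@leq_exp2r _ _ 2) //; apply: (@leq_trans ((4 * expn q 2 * expn n 3) * Q)).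
  apply: (@leq_trans ((4 * expn q 2 * expn n 3) * (n * expn p 2))).
    by rewrite !expnS !expn0; lia.
  by rewrite leq_mul.
by rewrite [expn Q 2]expnS expn1 leq_mul.
Qed.

(** * Asymptotics of the exponent *)

Theorem mainTheorem3 (F : finFieldType) :
  exists (C : R) (N : nat), forall n : nat, (N <= n)%nat ->
    exists e : R,
      Rabs e <= C * sqrt (INR n) * Rpower (INR #|F|) (- (INR n) / 4) /\
      INR (num_antichains F n) =
        Rpower 2 ((1 + e) * INR (gauss_binom F n (n %/ 2))).
Proof.
set q := #|F|; have q1 : (1 < q)%nat := card_gt1 F.
have [N hN] := eventually_cube_le_exp (4 * expn q 2) q1.
(* With s = sqrt n and w = sqrt Q, the term 10/p costs 20 s/w and the degree term costs 2 q s/w; the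
   outer q comes from 1/w <= q q^(-n/4). *)
exists ((20 + 2 * INR q) * INR q), (maxn N 2) => n; rewrite geq_max => /andP[Nn n1].
have n0 : (0 < n)%nat by exact: ltnW.
set L := gauss_binom F n (n %/ 2); set A := num_antichains F n.
set Q := expn q (n.-1)./2.
have [p [p0 npQ p2 p2']] := choose_scale q1 n0 (hN n Nn).
(* The parameter [r] is q n, since n p <= Q <= q^n <= (2^q)^n. *)
have nr : (n * p <= expn 2 (q * n))%nat.
  apply: (@leq_trans Q).
    apply: leq_trans npQ; rewrite mulnA mulnAC; apply: leq_pmull.
    by rewrite !muln_gt0 n0 (ltnW q1).
  rewrite expnM; apply: (@leq_trans (expn q n)).
    by rewrite leq_exp2l //; lia.
  by rewrite leq_exp2r // ltnW // ltn_expl.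
have up := ln_num_antichains_le n1 p0 nr npQ.
have QL : (Q <= L)%nat := leq_exp_gauss_binom F n1.
have pQ : (p <= Q)%nat.
  by apply: leq_trans p2; case: (p) => // k; rewrite expnS mulnCA leq_pmulr // muln_gt0 n0.
have pL := INR_leq (leq_trans pQ QL).
have lo := INR_leq (num_antichains_ge F n); rewrite two_powE -/L -/A in lo.
have A0 : 0 < INR A by apply: Rlt_le_trans lo; exact: exp_pos.
have p0' : 0 < INR p by exact: (INR_ltn p0).
have L0 : 0 < INR L by lra.
have n0' : 0 < INR n by exact: (INR_ltn n0).
have q1' : 1 < INR q by exact: (INR_ltn q1).
have l2 := ln_lt_2.
have lo' : INR L * ln 2 <= ln (INR A).
  by have := ln_le (exp_pos _) lo; rewrite /Rpower ln_exp.
(* The value forced by the required equality; the lower bound 2^L makes it nonnegative. *)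
set e := ln (INR A) / ln 2 / INR L - 1.
have e0 : 0 <= e.
  have -> : e = (ln (INR A) - INR L * ln 2) * / (ln 2 * INR L) by rewrite /e; field; lra.
  apply: Rmult_le_pos; first lra.
  by left; apply: Rinv_0_lt_compat; apply: Rmult_lt_0_compat; lra.
exists e; split; last first.
  rewrite /Rpower [X in exp X](_ : _ = ln (INR A)); first by rewrite exp_ln.
  by rewrite /e; field; lra.
rewrite Rabs_pos_eq //.
set s := sqrt (INR n); set w := Rpower (INR q) (INR (n.-1)./2 / 2).
have w0 : 0 < w by exact: exp_pos.
have s0 : 0 < s by exact: sqrt_lt_R0.
have ss : s * s = INR n by apply: sqrt_sqrt; lra.
have ww : w * w = INR Q.
  rewrite /w -Rpower_plus INR_expn -Rpower_pow; last lra.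
  by congr Rpower; field.
have sp : s * INR p <= w.
  apply: Rsqr_incr_0; [|apply: Rmult_le_pos; lra|lra].
  have := INR_leq p2; rewrite INR_muln [INR (expn p 2)]INR_expn /Rsqr /= -/Q -ww -ss; lra.
(* Maximality of p gives w <= s (p+1), and p >= 1 gives p+1 <= 2 p. *)
have sp' : w <= 2 * s * INR p.
  apply: Rle_trans (_ : s * (INR p + 1) <= _).
    apply: Rsqr_incr_0; [|lra|apply: Rmult_le_pos; lra].
    have := INR_leq (ltnW p2'); rewrite INR_muln [INR (expn p.+1 2)]INR_expn.
    rewrite S_INR /Rsqr /= -/Q -ww -ss; lra.
  have p1 : 1 <= INR p by exact: (INR_leq p0).
  have := Rmult_le_compat_l s _ _ (Rlt_le _ _ s0) p1; lra.
have wi := Rinv_0_lt_compat _ w0.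
have pi := Rinv_0_lt_compat _ p0'.
have invp : / INR p <= 2 * s / w.
  apply: (Rmult_le_reg_r (INR p * w)); first exact: Rmult_lt_0_compat.
  have -> : / INR p * (INR p * w) = w by field; lra.
  by have -> : 2 * s / w * (INR p * w) = 2 * s * INR p by field; lra.
have prQ : INR p * INR (q * n) / INR Q <= INR q * s / w.
  rewrite INR_muln -ww -ss.
  have -> : INR p * (INR q * (s * s)) / (w * w) = (s * INR p) * (INR q * s / (w * w)) by field; lra.
  have -> : INR q * s / w = w * (INR q * s / (w * w)) by field; lra.
  apply: Rmult_le_compat_r => //; apply: Rmult_le_pos; first by apply: Rmult_le_pos; lra.
  by left; apply: Rinv_0_lt_compat; apply: Rmult_lt_0_compat.
(* Here 10 = 8 + 2: 4 / ln 2 <= 8 because ln 2 > 1/2, and the additive 2 left by the zero and full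
   spaces is at most 2 L / p because p <= L. *)
have eL : e <= 10 * / INR p + 2 * (INR p * INR (q * n) / INR Q).
  have Q0 : 0 < INR Q by rewrite -ww; apply: Rmult_lt_0_compat.
  have h : ln (INR A) / ln 2 <=
      2 + INR L + 2 * INR p * INR (q * n) * INR L / INR Q + 8 * INR L / INR p.
    apply: (Rmult_le_reg_r (ln 2)); first lra.
    have -> : ln (INR A) / ln 2 * ln 2 = ln (INR A) by field; lra.
    apply: Rle_trans up _; rewrite [X in _ <= X]Rmult_plus_distr_r; apply: Rplus_le_compat_l.
    have X : 0 <= INR L / INR p by apply: Rmult_le_pos; lra.
    have := Rmult_le_compat_l _ _ _ X (Rlt_le _ _ l2).
    rewrite [4 * _ / _]Rmult_assoc [8 * _ / _]Rmult_assoc -/(INR L / INR p); lra.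
  apply: (Rmult_le_reg_r (INR L)) => //.
  have -> : e * INR L = ln (INR A) / ln 2 - INR L by rewrite /e; field; lra.
  have h2 : 2 <= 2 * INR L / INR p.
    apply: (Rmult_le_reg_r (INR p)) => //.
    have -> : 2 * INR L / INR p * INR p = 2 * INR L by field; lra.
    lra.
  have -> : (10 * / INR p + 2 * (INR p * INR (q * n) / INR Q)) * INR L =
    2 * INR p * INR (q * n) * INR L / INR Q + 8 * INR L / INR p + 2 * INR L / INR p by field; lra.
  lra.
(* Rounding in the exponent of Q loses at most a factor q^(1/2) in w, which the factor q absorbs. *)
have winv : / w <= INR q * Rpower (INR q) (- INR n / 4).
  rewrite /w -Rpower_Ropp -{2}(Rpower_1 (INR q)); last lra.
  rewrite -Rpower_plus; apply: Rle_Rpower; first lra.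
  have : (n <= 2 * (n.-1)./2 + 2)%nat by lia.
  by move/INR_leq; rewrite INR_addn INR_muln /=; lra.
have f0 : 0 <= (20 + 2 * INR q) * s by apply: Rmult_le_pos; lra.
have := Rmult_le_compat_l _ _ _ f0 winv.
rewrite /Rdiv in prQ invp eL *; nra.
Qed.
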